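(* Let $\frac13<r<3$ and $0<b<\frac{2}{3+r}$, and for $t\ge 2$ set $$\Omega(t):=\{(x,y)\in\mathbb{R}^2 : |x|<t^{b},\ |y|<t^{br}\}.$$ Let $u_0\in L^2(\mathbb{R}^2)$ and let $u=u(x,y,t)$, $u\in C(\mathbb{R}:L^2(\mathbb{R}^2))$, be the (bounded in time) solution of the two-dimensional Zakharov-Kuznetsov equation $\partial_t u+\partial_x\Delta u+u\,\partial_x u=0$ with $u(0)=u_0$. Then $$\liminf_{t\to\infty}\int_{\Omega(t)}u^2(x,y,t)\,dx\,dy=0.$$ Moreover, there exist a constant $C_0>0$ and an increasing sequence of times $t_n\to+\infty$ such that $$\int_{\Omega(t_n)}u^2(x,y,t_n)\,dx\,dy\le\frac{C_0}{\ln^{\frac1b-1}(t_n)}\quad\text{for all } n.$$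
   Context: Here $u$ is real valued, $(x,y)\in\mathbb{R}^2$, $t\in\mathbb{R}$, $\Delta=\partial_x^2+\partial_y^2$. The 2D Zakharov-Kuznetsov equation is globally well-posed in $L^2(\mathbb{R}^2)$ (a known result); ''the solution'' is the unique global one given by that well-posedness theory, and it conserves the $L^2(\mathbb{R}^2)$ norm, so it is bounded in time in $L^2$. The notation $\ln^{a}(t)$ means $(\ln t)^a$. *)

(* Defs.v *)
From HB Require Import structures.
From mathcomp Require Import all_boot all_order all_algebra.
From mathcomp Require Import all_classical all_reals all_analysis.

Set Implicit Arguments.
Unset Strict Implicit.
Unset Printing Implicit Defensive.

Import Order.TTheory GRing.Theory Num.Theory.
Import numFieldNormedType.Exports.

Local Open Scope classical_set_scope.
Local Open Scope ring_scope.

Definition leb2 (R : realType) :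
    {measure set (measurableTypeR R * measurableTypeR R) -> \bar R} :=
  (@lebesgue_measure R \x @lebesgue_measure R)%E.

Definition L2norm (R : realType) (f : R * R -> R) : \bar R :=
  ('N[leb2 R]_2%:E[EFin \o f])%E.

(* Functions of ((x, y), t). *)
Definition Dx (R : realType) (f : R * R * R -> R) : R * R * R -> R :=
  fun q => 'D_((1, 0, 0) : R * R * R) f q.
Definition Dy (R : realType) (f : R * R * R -> R) : R * R * R -> R :=
  fun q => 'D_((0, 1, 0) : R * R * R) f q.
Definition Dt (R : realType) (f : R * R * R -> R) : R * R * R -> R :=
  fun q => 'D_((0, 0, 1) : R * R * R) f q.

Definition laplacian (R : realType) (f : R * R * R -> R) : R * R * R -> R :=
  fun q => Dx (Dx f) q + Dy (Dy f) q.

Fixpoint is_Ck (R : realType) (k : nat) (f : R * R * R -> R) : Prop :=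
  continuous f /\
  if k is k'.+1 then
    [/\ forall q, [/\ derivable f q (1, 0, 0), derivable f q (0, 1, 0)
                    & derivable f q (0, 0, 1)],
        is_Ck k' (Dx f), is_Ck k' (Dy f) & is_Ck k' (Dt f)]
  else True.

Definition test_function (R : realType) (phi : R * R * R -> R) : Prop :=
  (forall k, is_Ck k phi) /\ compact (closure [set q | phi q != 0]).

(* A time-dependent function t |-> u(t) is given by representatives
   u t : R * R -> R of L^2 classes; every notion below is insensitive to the
   choice of the representatives. *)

Definition continuous_L2 (R : realType) (u : R -> R * R -> R) : Prop :=
  (forall t, u t \in Lfun (leb2 R) 2%:E) /\
  forall t0, L2norm (fun p => u t p - u t0 p) @[t --> t0] --> 0%E.

Definition bounded_L2 (R : realType) (u : R -> R * R -> R) : Prop :=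
  exists M : R, forall t, (L2norm (u t) <= M%:E)%E.

(* The equation u_t + (\Delta u)_x + u u_x = 0 in the sense of distributions
   on R^2 x R, with u u_x read as (u^2 / 2)_x.  Moving the derivatives onto
   the test function changes all three signs, whence the common sign below.
   For u in C(R : L^2) the inner integral is a continuous function of t with
   compact support, so the iterated integral is well defined. *)
Definition ZK_distributional (R : realType) (u : R -> R * R -> R) : Prop :=
  forall phi : R * R * R -> R, test_function phi ->
  (\int[@lebesgue_measure R]_t \int[leb2 R]_p
     (u t p * (Dt phi (p, t) + Dx (laplacian phi) (p, t))
      + (u t p) ^+ 2 / 2 * Dx phi (p, t))%:E = 0)%E.

(* A solution u in C(R : L^2), bounded in time, with data u0.  The flow of the
   global L^2 well-posedness theory is such a solution: it is a limit in
   C([-T, T] : L^2), for every T, of smooth solutions, and it conserves the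
   L^2 norm. *)
Definition ZK_solution (R : realType) (u0 : R * R -> R) (u : R -> R * R -> R)
    : Prop :=
  [/\ continuous_L2 u, bounded_L2 u, ZK_distributional u
    & {ae leb2 R, forall p, u 0 p = u0 p}].

Definition Omega (R : realType) (b r t : R) : set (R * R) :=
  [set p | `|p.1| < t `^ b /\ `|p.2| < t `^ (b * r)].

Definition local_mass (R : realType) (b r : R) (u : R -> R * R -> R) (t : R)
    : \bar R :=
  (\int[leb2 R]_(p in Omega b r t) ((u t p) ^+ 2)%:E)%E.

(* Main.v *)
Require Import Defs.
From HB Require Import structures.
From mathcomp Require Import all_boot all_order all_algebra.
From mathcomp Require Import all_classical all_reals all_analysis.
From mathcomp Require Import measurable_realfun.
From mathcomp Require Import ring lra.

Set Implicit Arguments.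
Unset Strict Implicit.
Unset Printing Implicit Defensive.

Import Order.TTheory GRing.Theory Num.Theory.
Import numFieldNormedType.Exports.

Local Open Scope classical_set_scope.
Local Open Scope ring_scope.

(* Test the equation against a fixed product f(x) g(y) h(t) adapted to a time
   window [S/2, S].  The profile f increases at the scale l = S^b and is cut off
   at a slightly larger scale L = S^(b+d), while g and h are bumps at the scales
   S^(br) and S.  The term u^2/2 f' g h then controls l^-1 times the mass in
   Omega(t), up to an error L^-1 |u|_2^2 coming from the cut-off; the terms linear
   in u are of size S^-1 + l^-3 + l^-1 S^(-2br) on the support, and are absorbed by
   Young's inequality.  The strict inequalities on r and b make all errors smaller
   than the main term by a power of S, so some t in [S/2, S] has mass at most
   K S^(-d), which beats every power of ln t.  Averaging in time replaces the
   integration of a differential inequality; only lower bounds of the time integrand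
   by step functions are needed, so no regularity in time is used. *)

(** * Smooth functions flat at the origin *)

(** The polynomial is kept as a parameter so that the family around the classical [exp(-1/x)] is
    closed under differentiation. *)
Definition flat (R : realType) (p : {poly R}) (x : R) : R :=
  if 0 < x then p.[x^-1] * expR (- x^-1) else 0.

(** [s ^+ n / n!] is one term of the exponential series, whose terms are all nonnegative for
    [0 <= s]. *)
Lemma exprn_expRN_le (R : realType) (n : nat) (s : R) :
  0 <= s -> s ^+ n * expR (- s) <= n`!%:R.
Proof.
move=> s0; rewrite expRN ler_pdivrMr ?expR_gt0//.
case: n => [|n].
  by rewrite expr0 fact0 mul1r (le_trans _ (expR_ge1Dx s))// lerDl.
rewrite mulrC -ler_pdivrMr ?ltr0n ?fact_gt0//.
by rewrite (le_trans _ (expR_ge1Dxn n s0))// lerDr.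
Qed.

Lemma flat_bounded (R : realType) (p : {poly R}) :
  exists C : R, forall x, `|flat p x| <= C.
Proof.
exists (\sum_(i < size p) `|p`_i| * i`!%:R) => x; rewrite /flat.
case: ifPn => x0; last by rewrite normr0 sumr_ge0// => i _; rewrite mulr_ge0.
rewrite horner_coef mulr_suml (le_trans (ler_norm_sum _ _ _))//.
apply: ler_sum => i _; rewrite -mulrA normrM ler_wpM2l// ger0_norm.
  by rewrite exprn_expRN_le// invr_ge0 ltW.
by rewrite mulr_ge0 ?expR_ge0// exprn_ge0// invr_ge0 ltW.
Qed.

Lemma flatXM (R : realType) (p : {poly R}) (x : R) :
  flat ('X * p) x = x^-1 * flat p x.
Proof.
rewrite /flat; case: ifPn => _; last by rewrite mulr0.
by rewrite hornerM hornerX mulrA.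
Qed.

(** For [0 < x], put [s = 1/x]: then [ds/dx = - s^2], whence the factor [X^2], and [p - p'] comes
    from the product rule for [p(s) exp(-s)]. *)
Lemma is_derive_flat (R : realType) (p : {poly R}) (x : R) :
  is_derive x 1 (flat p) (flat ('X * ('X * (p - p^`()))) x).
Proof.
have [x0|x0|->] := ltgtP x 0.
- apply: (@near_eq_is_derive _ _ _ (cst 0)).
    near=> y; rewrite /flat ltNge ltW//=.
    by near: y; exact: lt_nbhsl.
  by rewrite /flat ltNge ltW//=; exact: is_derive_cst.
- apply: (@near_eq_is_derive _ _ _ (fun y : R => p.[y^-1] * expR (- y^-1))).
    near=> y; rewrite /flat ifT//.
    by near: y; exact: lt_nbhsr.
  have xV : is_derive x 1 (fun y : R => y^-1) (- x ^- 2 *: 1).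
    by apply: is_deriveV; rewrite gt_eqF.
  have Np : is_derive x 1 (fun y : R => - y^-1) (- (- x ^- 2 *: 1)).
    exact: is_deriveN.
  have dp := @is_derive1_comp _ (horner p) (fun y : R => y^-1) x _ _
    (is_derive_poly p _) xV.
  have de := @is_derive1_comp _ expR (fun y : R => - y^-1) x _ _
    (is_derive_expR _) Np.
  apply: (is_derive_eq (is_deriveM dp de)).
  rewrite /flat x0 !hornerM hornerD hornerN !hornerX /GRing.scale/= -exprVn.
  by ring.
(* At the origin the difference quotient is [h] times the value at [h] of the flat function of
   [X^2 p], which is bounded; hence it tends to 0. *)
- have [C hC] := flat_bounded ('X * ('X * p)).
  have p0 : flat p 0 = 0 by rewrite /flat ltxx.
  have lim0 : h^-1 *: ((flat p \o shift 0) (h *: (1:R)) - flat p 0)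
      @[h --> 0^'] --> (0 : R).
    apply/cvgr0Pnorm_lt => e e0; near=> h.
    have h0 : h != 0 by near: h; exact: nbhs_dnbhs_neq.
    rewrite /= addr0 p0 subr0 [h%:A]mulr1.
    have -> : h^-1 *: flat p h = h * flat ('X * ('X * p)) h.
      by rewrite !flatXM mulVKf.
    rewrite normrM (@le_lt_trans _ _ (`|h| * (`|C| + 1)))//.
      rewrite ler_wpM2l// (le_trans (hC _))// (le_trans (ler_norm _))//.
      by rewrite lerDl.
    rewrite -ltr_pdivlMr ?ltr_wpDl//.
    by near: h; apply: dnbhs0_lt; rewrite divr_gt0 ?ltr_wpDl.
  split; first by apply/cvg_ex; exists 0.
  rewrite /derive (cvg_lim _ lim0)//.
  by rewrite /flat ltxx.
Unshelve. all: by end_near.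
Qed.

(** * Calculus of bounds on derivatives *)

(* [deriv_bound n a C g]: [g] has derivatives up to order [n.+1], and
   [|g^(k)| <= C * a ^+ k] for [k <= n]. *)
Fixpoint deriv_bound (R : realType) (n : nat) (a C : R) (g : R -> R) : Prop :=
  [/\ forall x, `|g x| <= C, forall x, derivable g x 1
    & if n is n'.+1 then deriv_bound n' a (C * a) (derive1 g) else True].

Definition smoothb (R : realType) (g : R -> R) : Prop :=
  forall n, exists2 C, 0 <= C & deriv_bound n 1 C g.

Lemma deriv_bound_le (R : realType) n (a a' C C' : R) g :
  0 <= a <= a' -> 0 <= C <= C' -> deriv_bound n a C g -> deriv_bound n a' C' g.
Proof.
move=> /andP[a0 aa']; elim: n C C' g => [|n IH] C C' g /andP[C0 CC'] [gC dg H].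
  by split=> // x; rewrite (le_trans (gC x)).
split=> //; first by move=> x; rewrite (le_trans (gC x)).
by apply: IH H; rewrite mulr_ge0//= ler_pM.
Qed.

Lemma deriv_bound_ltn (R : realType) n (a C : R) g :
  deriv_bound n.+1 a C g -> deriv_bound n a C g.
Proof.
elim: n C g => [|n IH] C g [gC dg H]; split=> //; exact: IH.
Qed.

Lemma derive1_smoothb (R : realType) (g : R -> R) :
  smoothb g -> smoothb (derive1 g).
Proof.
by move=> sg n; have [C C0 [_ _ H]] := sg n.+1; exists C => //; rewrite mulr1 in H.
Qed.

Lemma smoothb_derivable (R : realType) (g : R -> R) :
  smoothb g -> forall x, derivable g x 1.
Proof. by move=> sg; have [C _ []] := sg 0%N. Qed.

Lemma smoothb_continuous (R : realType) (g : R -> R) :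
  smoothb g -> continuous g.
Proof.
move=> sg x; apply/differentiable_continuous/derivable1_diffP.
exact: smoothb_derivable.
Qed.

Lemma derive1_add (R : realType) (f g : R -> R) :
  (forall x, derivable f x 1) -> (forall x, derivable g x 1) ->
  derive1 (fun x => f x + g x) = (fun x => derive1 f x + derive1 g x).
Proof.
by move=> df dg; apply/funext => x; rewrite !derive1E (deriveD (df x) (dg x)).
Qed.

Lemma derive1_mul (R : realType) (f g : R -> R) :
  (forall x, derivable f x 1) -> (forall x, derivable g x 1) ->
  derive1 (fun x => f x * g x)
  = (fun x => derive1 f x * g x + f x * derive1 g x).
Proof.
move=> df dg; apply/funext => x; rewrite !derive1E (deriveM (df x) (dg x)).
by rewrite addrC /GRing.scale/= [g x * _]mulrC.
Qed.

Lemma deriv_boundD (R : realType) n (a C D : R) f g :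
  deriv_bound n a C f -> deriv_bound n a D g ->
  deriv_bound n a (C + D) (fun x => f x + g x).
Proof.
elim: n C D f g => [|n IH] C D f g [fC df Hf] [gD dg Hg].
  split=> [x|x|//]; first by rewrite (le_trans (ler_normD _ _))// lerD.
  exact: derivableD.
split=> [x|x|]; first by rewrite (le_trans (ler_normD _ _))// lerD.
  exact: derivableD.
by rewrite derive1_add// mulrDl; exact: IH.
Qed.

(* Each derivative doubles the number of terms, whence the factor [2]. *)
Lemma deriv_boundM (R : realType) n (a C D : R) f g :
  deriv_bound n a C f -> deriv_bound n a D g ->
  deriv_bound n (2 * a) (C * D) (fun x => f x * g x).
Proof.
elim: n C D f g => [|n IH] C D f g [fC df Hf] [gD dg Hg].
  split=> [x|x|//]; first by rewrite normrM ler_pM.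
  exact: derivableM.
split=> [x|x|]; first by rewrite normrM ler_pM.
  exact: derivableM.
rewrite derive1_mul//.
have -> : C * D * (2 * a) = C * a * D + C * (D * a) by ring.
apply: deriv_boundD; apply: IH => //; exact: deriv_bound_ltn.
Qed.

Lemma derive1_affine (R : realType) (s c : R) (g : R -> R) :
  (forall x, derivable g x 1) ->
  derive1 (fun x => g (s * x + c)) = (fun x => s * derive1 g (s * x + c)) /\
  forall x : R, derivable (fun x : R => g (s * x + c)) x 1.
Proof.
move=> dg.
have H (x : R) : is_derive x 1 (fun x : R => g (s * x + c))
    (s * derive1 g (s * x + c)).
  have da : is_derive x 1 (fun x : R => s * x + c) s.
    apply: (is_derive_eq (is_deriveD (is_deriveZ s (is_derive_id x 1))
      (is_derive_cst c x 1))).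
    by rewrite addr0 [_ *: _]mulr1.
  have dg' : is_derive (s * x + c) 1 g (derive1 g (s * x + c)).
    by rewrite derive1E; exact: derivableP.
  have := @is_derive1_comp _ g (fun x : R => s * x + c) x _ _ dg' da.
  by rewrite mulrC.
split=> [|x]; last by have [] := H x.
by apply/funext => x; rewrite derive1E; have [_ ->] := H x.
Qed.

Lemma deriv_boundZ (R : realType) n (a C s : R) g :
  deriv_bound n a C g -> deriv_bound n a (`|s| * C) (fun x => s * g x).
Proof.
elim: n C g => [|n IH] C g [gC dg H]; split=> [x|x|]//.
- by rewrite normrM ler_wpM2l.
- exact: (derivableM (derivable_cst _ _ _)).
- by rewrite normrM ler_wpM2l.
- exact: (derivableM (derivable_cst _ _ _)).
rewrite -mulrA (_ : derive1 _ = fun x => s * derive1 g x); first exact: IH.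
have dc (x : R) : derivable (cst s) x 1 by exact: derivable_cst.
rewrite (derive1_mul dc dg).
by apply/funext => x; rewrite derive1_cst mul0r add0r.
Qed.

(** Every derivative of the composite brings out one factor [s], which is absorbed in the rate [a].
    This is how the scales of the profiles enter the estimates. *)
Lemma deriv_bound_affine (R : realType) n (a C s c : R) g :
  deriv_bound n a C g ->
  deriv_bound n (`|s| * a) C (fun x => g (s * x + c)).
Proof.
elim: n C g => [|n IH] C g [gC dg H]; have [e d] := derive1_affine s c dg.
  by split.
split=> //; rewrite e mulrCA; apply: deriv_boundZ; exact: IH.
Qed.

(** Only finitely many orders are involved, so the sum of the bounds [C * a ^+ k] serves at rate
    1. *)
Lemma deriv_bound1 (R : realType) n (a C : R) g : 0 <= a -> 0 <= C ->
  deriv_bound n a C g -> exists2 D, 0 <= D & deriv_bound n 1 D g.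
Proof.
move=> a0; elim: n C g => [|n IH] C g C0 [gC dg H]; first by exists C.
have [D D0 HD] := IH _ _ (mulr_ge0 C0 a0) H.
exists (C + D); first by rewrite addr_ge0.
split=> [x|//|]; first by rewrite (le_trans (gC x))// lerDl.
by apply: deriv_bound_le HD; rewrite ?ler01 ?lexx// D0 mulr1 lerDr.
Qed.

Lemma smoothbM (R : realType) (f g : R -> R) :
  smoothb f -> smoothb g -> smoothb (fun x => f x * g x).
Proof.
move=> sf sg n; have [C C0 fC] := sf n; have [D D0 gD] := sg n.
apply: (deriv_bound1 _ _ (deriv_boundM fC gD)); first by rewrite mulr1.
exact: mulr_ge0.
Qed.

Lemma smoothb_affine (R : realType) (s c : R) (g : R -> R) :
  smoothb g -> smoothb (fun x => g (s * x + c)).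
Proof.
move=> sg n; have [C C0 gC] := sg n.
by apply: (deriv_bound1 _ C0 (deriv_bound_affine s c gC)); rewrite mulr1.
Qed.

(** All derivatives stay in the family of flat functions, each of which is bounded. *)
Lemma smoothb_flat (R : realType) (p : {poly R}) : smoothb (flat p).
Proof.
move=> n; elim: n p => [|n IH] p; have [C hC] := flat_bounded p;
  have C0 : 0 <= C by rewrite (le_trans _ (hC 0)).
  by exists C => //; split=> // x; have [] := is_derive_flat p x.
have [D D0 HD] := IH ('X * ('X * (p - p^`()))).
exists (C + D); first by rewrite addr_ge0.
split=> [x|x|]; first by rewrite (le_trans (hC x))// lerDl.
  by have [] := is_derive_flat p x.
have -> : derive1 (flat p) = flat ('X * ('X * (p - p^`()))).
  by apply/funext => x; rewrite derive1E; have [_ ->] := is_derive_flat p x.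
by apply: deriv_bound_le HD; rewrite ?ler01 ?lexx// D0 mulr1 lerDr.
Qed.

(** * The bump function and the increasing profile *)

(** The region [m < |x|] is open, so [g] vanishes on a neighbourhood of each of its points. *)
Lemma derive1_eq0_outside (R : realType) (m : R) (g : R -> R) :
  (forall x, m < `|x| -> g x = 0) -> forall x, m < `|x| -> derive1 g x = 0.
Proof.
move=> g0 x mx; rewrite derive1E (@near_eq_derive _ _ _ _ (cst 0)).
  by have [_ ->] := is_derive_cst (0 : R) x (1 : R).
near=> y; apply: g0; near: y.
have := @norm_continuous _ R x; move/cvgr_gt => /(_ _ mx); exact.
Unshelve. all: by end_near.
Qed.

(** Two opposite flat functions multiplied together: positive exactly on []-2, 2[]. No plateau is
    required, only a positive lower bound on [[-1, 1]]. *)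
Definition bump (R : realType) (x : R) : R :=
  flat 1 (-1 * x + 2) * flat 1 (1 * x + 2).

Lemma smoothb_bump (R : realType) : smoothb (@bump R).
Proof. by apply: smoothbM; apply: smoothb_affine; exact: smoothb_flat. Qed.

Lemma flat1_ge0 (R : realType) (x : R) : 0 <= flat 1 x.
Proof.
by rewrite /flat; case: ifP => // _; rewrite hornerE mul1r expR_ge0.
Qed.

Lemma flat1_ge (R : realType) (x : R) : 1 <= x -> expR (-1) <= flat 1 x.
Proof.
move=> x1; have x0 : 0 < x by rewrite (lt_le_trans ltr01).
by rewrite /flat x0 hornerE mul1r ler_expR lerN2 invf_le1.
Qed.

Lemma derive1_flat1 (R : realType) (x : R) :
  derive1 (flat 1) x = if 0 < x then x^-1 ^+ 2 * expR (- x^-1) else 0.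
Proof.
rewrite derive1E; have [_ ->] := is_derive_flat 1 x.
rewrite /flat; case: ifP => // _.
by rewrite -polyC1 derivC subr0 !hornerM hornerX hornerC mulr1 expr2.
Qed.

Lemma derive1_flat1_ge0 (R : realType) (x : R) : 0 <= derive1 (flat 1) x.
Proof.
rewrite derive1_flat1; case: ifP => // _.
by rewrite mulr_ge0 ?expR_ge0// exprn_even_ge0.
Qed.

(** The interval [[1, 3]] is the image of [|x| <= l] under [x / l + 2], the change of variable made
    in [step_profile]. *)
Lemma derive1_flat1_ge (R : realType) (x : R) :
  1 <= x <= 3 -> expR (-1) / 9 <= derive1 (flat 1) x.
Proof.
move=> /andP[x1 x3]; have x0 : 0 < x by rewrite (lt_le_trans ltr01).
rewrite derive1_flat1 x0 mulrC ler_pM ?invr_ge0 ?expR_ge0 ?ler0n//.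
  rewrite exprVn lef_pV2 ?posrE ?exprn_gt0 ?ltr0n//.
  by nra.
by rewrite ler_expR lerN2 invf_le1.
Qed.

Lemma bump_ge0 (R : realType) (x : R) : 0 <= bump x.
Proof. by rewrite mulr_ge0 ?flat1_ge0. Qed.

Lemma bump_ge (R : realType) (x : R) :
  `|x| <= 1 -> expR (-1) * expR (-1) <= bump x.
Proof.
by rewrite ler_norml => /andP[? ?]; rewrite ler_pM ?expR_ge0 ?flat1_ge//; lra.
Qed.

Lemma bump_eq0 (R : realType) (x : R) : 2 < `|x| -> bump x = 0.
Proof.
rewrite ltr_normr => /orP[] h; rewrite /bump /flat.
  by rewrite [0 < -1 * x + 2]ltNge (_ : _ <= 0) ?mul0r//; lra.
by rewrite [0 < 1 * x + 2]ltNge (_ : _ <= 0) ?mulr0//; lra.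
Qed.

Lemma normr_le_itv (R : realType) (m : R) :
  [set x : R | `|x| <= m] = `[- m, m]%classic.
Proof. by apply/seteqP; split=> x /=; rewrite in_itv/= -ler_norml. Qed.

(** * Product test functions and their partial derivatives *)

Definition tensor3 (R : realType) (f g h : R -> R) (q : R * R * R) : R :=
  f q.1.1 * g q.1.2 * h q.2.

(** On the line through [q] directed by [v], [f] is a translate of [g] times a constant, so the
    difference quotients agree up to that constant. Partial derivatives of products thus reduce to
    one variable. *)
Lemma is_derive_along (R : realType) (V : normedModType R) (f : V -> R)
    (q v : V) (g : R -> R) (x c : R) :
  (forall h, f (h *: v + q) = g (h + x) * c) -> derivable g x 1 ->
  is_derive q v f (derive1 g x * c).
Proof.
move=> fg dg.
have lim : h^-1 *: ((f \o shift q) (h *: v) - f q) @[h --> 0^']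
    --> derive1 g x * c.
  have -> : (fun h => h^-1 *: ((f \o shift q) (h *: v) - f q)) =
      (fun h => (h^-1 *: ((g \o shift x) (h *: 1) - g x)) * c).
    apply/funext => h /=; have := fg 0; rewrite scale0r !add0r => ->.
    by rewrite fg [h *: 1]mulr1 -mulrBl [LHS]mulrA.
  by apply: cvgM; [rewrite derive1E; exact: dg|exact: cvg_cst].
by split; [apply/cvg_ex; exists (derive1 g x * c)|exact: cvg_lim lim].
Qed.

Lemma is_derive_tensor3_x (R : realType) (f g h : R -> R) (q : R * R * R) :
  derivable f q.1.1 1 ->
  is_derive q ((1, 0, 0) : R * R * R) (tensor3 f g h)
    (tensor3 (derive1 f) g h q).
Proof.
move=> df; apply: is_derive_eq; last by rewrite /tensor3 -mulrA.
apply: is_derive_along df => k.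
by rewrite /tensor3/= !scaler0 !add0r [k *: 1]mulr1 mulrA.
Qed.

Lemma is_derive_tensor3_y (R : realType) (f g h : R -> R) (q : R * R * R) :
  derivable g q.1.2 1 ->
  is_derive q ((0, 1, 0) : R * R * R) (tensor3 f g h)
    (tensor3 f (derive1 g) h q).
Proof.
move=> dg; apply: is_derive_eq; last by rewrite /tensor3 mulrAC mulrC.
apply: is_derive_along dg => k.
by rewrite /tensor3/= !scaler0 !add0r [k *: 1]mulr1 mulrAC mulrC.
Qed.

Lemma is_derive_tensor3_t (R : realType) (f g h : R -> R) (q : R * R * R) :
  derivable h q.2 1 ->
  is_derive q ((0, 0, 1) : R * R * R) (tensor3 f g h)
    (tensor3 f g (derive1 h) q).
Proof.
move=> dh; apply: is_derive_eq; last by rewrite /tensor3 mulrC.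
apply: is_derive_along dh => k.
by rewrite /tensor3/= !scaler0 !add0r [k *: 1]mulr1 mulrC.
Qed.

Lemma Dx_tensor3 (R : realType) (f g h : R -> R) : smoothb f ->
  Dx (tensor3 f g h) = tensor3 (derive1 f) g h.
Proof.
move=> sf; apply/funext => q; rewrite /Dx.
by have [_ ->] := is_derive_tensor3_x g h (@smoothb_derivable _ _ sf q.1.1).
Qed.

Lemma Dy_tensor3 (R : realType) (f g h : R -> R) : smoothb g ->
  Dy (tensor3 f g h) = tensor3 f (derive1 g) h.
Proof.
move=> sg; apply/funext => q; rewrite /Dy.
by have [_ ->] := is_derive_tensor3_y f h (@smoothb_derivable _ _ sg q.1.2).
Qed.

Lemma Dt_tensor3 (R : realType) (f g h : R -> R) : smoothb h ->
  Dt (tensor3 f g h) = tensor3 f g (derive1 h).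
Proof.
move=> sh; apply/funext => q; rewrite /Dt.
by have [_ ->] := is_derive_tensor3_t f g (@smoothb_derivable _ _ sh q.2).
Qed.

Lemma Dx_laplacian_tensor3 (R : realType) (f g h : R -> R) (q : R * R * R) :
  smoothb f -> smoothb g -> smoothb h ->
  Dx (laplacian (tensor3 f g h)) q =
  tensor3 (derive1 (derive1 (derive1 f))) g h q
  + tensor3 (derive1 f) (derive1 (derive1 g)) h q.
Proof.
move=> sf sg sh.
have sf1 := derive1_smoothb sf; have sf2 := derive1_smoothb sf1.
have sg1 := derive1_smoothb sg.
have -> : laplacian (tensor3 f g h) = tensor3 (derive1 (derive1 f)) g h
    + tensor3 f (derive1 (derive1 g)) h.
  by apply/funext => p; rewrite /laplacian !Dx_tensor3// !Dy_tensor3.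
have [dxx exx] := is_derive_tensor3_x g h (@smoothb_derivable _ _ sf2 q.1.1).
have [dyy eyy] :=
  is_derive_tensor3_x (derive1 (derive1 g)) h (@smoothb_derivable _ _ sf q.1.1).
by rewrite /Dx deriveD// exx eyy.
Qed.

(** Each partial derivative of a product is again a product of functions in [smoothb], so induction
    on [k] applies with the factors generalized. *)
Lemma is_Ck_tensor3 (R : realType) k (f g h : R -> R) :
  smoothb f -> smoothb g -> smoothb h -> is_Ck k (tensor3 f g h).
Proof.
elim: k f g h => [|k IH] f g h sf sg sh.
all: have cont : continuous (tensor3 f g h).
1,3: move=> q; apply: cvgM; [apply: cvgM|].
1,4: by apply: (@continuous_comp _ _ _ (fun q => q.1.1) f);
  [apply: (@continuous_comp _ _ _ fst fst); exact: cvg_fst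
  |exact: smoothb_continuous].
1,3: by apply: (@continuous_comp _ _ _ (fun q => q.1.2) g);
  [apply: (@continuous_comp _ _ _ fst snd); [exact: cvg_fst|exact: cvg_snd]
  |exact: smoothb_continuous].
1,2: by apply: (@continuous_comp _ _ _ snd h);
  [exact: cvg_snd|exact: smoothb_continuous].
  by split.
split=> //; split.
- move=> q; split.
  + by have [] := is_derive_tensor3_x g h (@smoothb_derivable _ _ sf q.1.1).
  + by have [] := is_derive_tensor3_y f h (@smoothb_derivable _ _ sg q.1.2).
  + by have [] := is_derive_tensor3_t f g (@smoothb_derivable _ _ sh q.2).
- by rewrite Dx_tensor3//; apply: IH => //; exact: derive1_smoothb.
- by rewrite Dy_tensor3//; apply: IH => //; exact: derive1_smoothb.
- by rewrite Dt_tensor3//; apply: IH => //; exact: derive1_smoothb.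
Qed.

(** The support lies in a product of three segments, which is compact and closed. *)
Lemma test_function_tensor3 (R : realType) (a b c : R) (f g h : R -> R) :
  smoothb f -> smoothb g -> smoothb h ->
  (forall x, a < `|x| -> f x = 0) -> (forall x, b < `|x| -> g x = 0) ->
  (forall x, c < `|x| -> h x = 0) -> test_function (tensor3 f g h).
Proof.
move=> sf sg sh f0 g0 h0; split; first by move=> k; exact: is_Ck_tensor3.
have cK (m : R) : compact [set x : R | `|x| <= m].
  by rewrite normr_le_itv; exact: segment_compact.
have cKK := compact_setX (compact_setX (cK a) (cK b)) (cK c).
apply: (subclosed_compact _ cKK); first exact: closed_closure.
rewrite [X in _ `<=` X](_ : _ = closure
  ([set x : R | `|x| <= a] `*` [set x : R | `|x| <= b]
    `*` [set x : R | `|x| <= c])); last first.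
  by apply/closure_id/(compact_closed _ cKK); exact: norm_hausdorff.
apply: closure_subset => q /=; rewrite /tensor3 => q0.
split; [split|] => /=; rewrite leNgt; apply: contra q0 => /[dup] + _.
- by move=> /f0 ->; rewrite !mul0r.
- by move=> /g0 ->; rewrite mulr0 mul0r.
- by move=> /h0 ->; rewrite mulr0.
Qed.

(** * Integration of lower bounds *)

(* The integral of an arbitrary function is the difference of the suprema of
   the integrals of simple functions below its positive and negative parts, so
   that it is monotone even without measurability. *)
Lemma le_integral_nomeas d (T : measurableType d) (R : realType)
    (mu : {measure set T -> \bar R}) (f g : T -> \bar R) :
  (forall x, f x <= g x)%E -> (\int[mu]_x f x <= \int[mu]_x g x)%E.
Proof.
move=> fg.
have H (h k : T -> \bar R) : (forall x, 0 <= h x)%E ->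
    (forall x, h x <= k x)%E -> (\int[mu]_x h x <= \int[mu]_x k x)%E.
  move=> h0 hk; rewrite !ge0_integralTE//; last first.
    by move=> x; rewrite (le_trans (h0 x)).
  apply: le_ereal_sup => _ [s sh <-]; exists s => // x.
  exact: le_trans (sh x) (hk x).
rewrite integralE [leRHS]integralE; apply: leeB; apply: H => x.
- exact: funepos_ge0.
- by rewrite !funeposE ge_max le_max fg/= le_max lexx orbT.
- exact: funeneg_ge0.
- by rewrite !funenegE ge_max le_max leeN2 fg/= le_max lexx orbT.
Qed.

Lemma sqr_L2norm_le (R : realType) (w : R * R -> R) (M : R) :
  (L2norm w <= M%:E)%E -> (\int[leb2 R]_p ((w p) ^+ 2)%:E <= (M ^+ 2)%:E)%E.
Proof.
move=> wM; have w0 : (0 <= L2norm w)%E by exact: Lnorm_ge0.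
have -> : (\int[leb2 R]_p ((w p) ^+ 2)%:E = L2norm w `^ 2)%E.
  rewrite /L2norm poweR_Lnorm//; apply: eq_integral => p _ /=.
  by rewrite powR_mulrn// -normrX ger0_norm// sqr_ge0.
have M0 : 0 <= M by rewrite -lee_fin (le_trans w0).
case: (L2norm w) w0 wM => [x| |]//=; rewrite !lee_fin => x0 xM.
by rewrite powR_mulrn// lerXn2r.
Qed.

(** Integrates a pointwise minorant at a fixed time: [A] is to be the inner region, [Q] the box
    supporting the test function. Integrability is checked on the minorant alone. *)
Lemma integral_ge_box d (T : measurableType d) (R : realType)
    (mu : {measure set T -> \bar R}) (w : T -> R) (A Q : set T)
    (F : T -> \bar R) (c e D E V : R) :
  mu.-integrable setT (EFin \o (fun x => w x ^+ 2)) ->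
  measurable A -> measurable Q -> 0 <= e -> 0 <= D ->
  (\int[mu]_x (w x ^+ 2)%:E <= E%:E)%E -> (mu Q <= V%:E)%E ->
  (forall x, (c * (w x ^+ 2 * \1_A x) - (e * w x ^+ 2 + D * \1_Q x))%:E
    <= F x)%E ->
  (c%:E * \int[mu]_(x in A) (w x ^+ 2)%:E - (e * E + D * V)%:E
    <= \int[mu]_x F x)%E.
Proof.
move=> iw mA mQ e0 D0 wE QV LF.
have iQ : mu.-integrable setT (EFin \o (\1_Q : T -> R)).
  apply/integrableP; split; first exact/measurable_EFinP/measurable_indic.
  under eq_integral do rewrite /= ger0_norm//.
  by rewrite integral_indic// setIT (le_lt_trans QV)// ltry.
have eA : (fun x => w x ^+ 2 * \1_A x) = (fun x => w x ^+ 2) \_ A.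
  apply/funext => x; rewrite patchE indicE.
  by case: ifPn => _; rewrite ?mulr1 ?mulr0.
have iA : mu.-integrable setT (EFin \o (fun x => w x ^+ 2 * \1_A x)).
  rewrite eA -restrict_EFin; apply/(integrable_mkcond _ mA).
  exact: (integrableS _ _ _ iw).
have iZ (k : R) (f : T -> R) : mu.-integrable setT (EFin \o f) ->
    mu.-integrable setT (EFin \o (fun x => k * f x)).
  by move=> i; exact: (integrableZl measurableT k i).
have iD : mu.-integrable setT (EFin \o (fun x => e * w x ^+ 2 + D * \1_Q x)).
  exact: (integrableD measurableT (iZ _ _ iw) (iZ _ _ iQ)).
apply: le_trans (le_integral_nomeas mu LF).
rewrite (integralB_EFin measurableT (iZ _ _ iA) iD).
apply: leeB.
  under [leRHS]eq_integral do rewrite EFinM.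
  rewrite (integralZl measurableT iA).
  by rewrite [in leLHS]integral_mkcond restrict_EFin -eA.
rewrite (integralD_EFin measurableT (iZ _ _ iw) (iZ _ _ iQ)) EFinD.
apply: leeD.
- under eq_integral do rewrite /= EFinM.
  by rewrite integralZl// EFinM lee_wpmul2l// lee_fin.
- under eq_integral do rewrite /= EFinM.
  by rewrite integralZl// integral_indic// setIT EFinM lee_wpmul2l// lee_fin.
Qed.

Lemma normr_lt_itv (R : realType) (m : R) :
  [set x : R | `|x| < m] = `]- m, m[%classic.
Proof. by apply/seteqP; split=> x /=; rewrite in_itv/= -ltr_norml. Qed.

Lemma leb2_box (R : realType) (a b : R) : 0 <= a -> 0 <= b ->
  leb2 R ([set x : R | `|x| <= a] `*` [set x : R | `|x| <= b])
    = (4 * a * b)%:E.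
Proof.
move=> a0 b0; rewrite !normr_le_itv.
transitivity (lebesgue_measure `[(- a)%R, a]%classic
    * lebesgue_measure `[(- b)%R, b]%classic)%E.
  by apply: product_measure1E; exact: measurable_itv.
by rewrite !lebesgue_measure_itv/= !lte_fin; case: ifPn; case: ifPn;
  rewrite -?leNgt => ? ?; rewrite -?EFinB -?EFinM; congr EFin; nra.
Qed.

Lemma measurable_Omega (R : realType) (a b : R) :
  measurable ([set p | `|p.1| < a /\ `|p.2| < b]
    : set (measurableTypeR R * measurableTypeR R)).
Proof.
rewrite (_ : [set _ | _] = [set x : R | `|x| < a] `*` [set x : R | `|x| < b])//.
by rewrite !normr_lt_itv; apply: measurableX.
Qed.

(** The two intervals have lengths [S / 2] and [4 * S], of ratio 8. *)
Lemma integral0_window (R : realType) (h : R -> \bar R) (S k B : R) :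
  0 < S -> 0 <= k -> 0 <= B ->
  (\int[@lebesgue_measure R]_t h t = 0)%E ->
  (forall t, (k * \1_(`[S / 2, S]%classic) t
    - B * \1_(`[- (2 * S), 2 * S]%classic) t)%:E <= h t)%E ->
  k <= 8 * B.
Proof.
move=> S0 k0 B0 h0 hle; have := le_integral_nomeas lebesgue_measure hle.
have iZ (c x y : R) : (@lebesgue_measure R).-integrable setT
    (EFin \o (fun t : R => c * \1_(`[x, y]%classic) t)).
  exact: (integrableZl measurableT c (integrable_indic_itv x y true false)).
have eZ (c x y : R) : x <= y ->
    (\int[@lebesgue_measure R]_t (c * \1_(`[x, y]%classic) t)%:E
     = (c * (y - x))%:E)%E.
  move=> xy; under eq_integral do rewrite EFinM.
  rewrite integralZl//; last exact: integrable_indic_itv.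
  rewrite integral_indic// setIT [X in (_ * X)%E](lebesgue_measure_itv `[x, y])/=.
  rewrite lte_fin EFinM.
  case: ifPn => [_|]; first by rewrite EFinB.
  by rewrite -leNgt => yx; congr (_ * _)%E; congr EFin; lra.
rewrite h0 (integralB_EFin measurableT (iZ _ _ _) (iZ _ _ _)).
rewrite !eZ; [|lra|lra].
rewrite -EFinB lee_fin; nra.
Qed.

(** * Profiles at prescribed scales *)

Lemma smoothb_two (R : realType) n (f g : R -> R) : smoothb f -> smoothb g ->
  exists2 C, 0 < C & deriv_bound n 1 C f /\ deriv_bound n 1 C g.
Proof.
move=> sf sg; have [C C0 fC] := sf n; have [D D0 gD] := sg n.
exists (C + D + 1); first by rewrite ltr_wpDl ?addr_ge0.
by split; [apply: deriv_bound_le fC|apply: deriv_bound_le gD];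
  rewrite ?ler01 ?lexx// ?C0 ?D0; lra.
Qed.

Lemma affine_eq0_outside (R : realType) (m : R) (g : R -> R) : 0 < m ->
  (forall x, 2 < `|x| -> g x = 0) ->
  forall x, 2 * m < `|x| -> g (m^-1 * x + 0) = 0.
Proof.
move=> m0 g0 x mx; apply: g0; rewrite addr0 normrM gtr0_norm ?invr_gt0//.
by rewrite mulrC ltr_pdivlMr.
Qed.

Lemma affine_norm_le1 (R : realType) (m x : R) : 0 < m -> `|x| <= m ->
  `|m^-1 * x + 0| <= 1.
Proof.
move=> m0 mx; rewrite addr0 normrM gtr0_norm ?invr_gt0//.
by rewrite mulrC ler_pdivrMr// mul1r.
Qed.

(** The constants are chosen before the scale [m]: rescaling the fixed bump costs one factor [1 / m]
    per derivative. *)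
Lemma bump_profile (R : realType) : exists c C : R, [/\ 0 < c, 0 < C &
  forall m, 0 < m -> exists g : R -> R,
    [/\ smoothb g, forall x, 2 * m < `|x| -> g x = 0,
        forall x, [/\ 0 <= g x, g x <= C, `|derive1 g x| <= C / m
                    & `|derive1 (derive1 g) x| <= C / m ^+ 2]
      & forall x, `|x| <= m -> c <= g x]].
Proof.
have [C C0 [bC _]] := smoothb_two 2 (smoothb_bump R) (smoothb_bump R).
exists (expR (-1) * expR (-1)), C; split; [by rewrite mulr_gt0 ?expR_gt0|by []|].
move=> m m0; exists (fun x => bump (m^-1 * x + 0)); split.
- by apply: smoothb_affine; exact: smoothb_bump.
- exact: affine_eq0_outside m0 (@bump_eq0 R).
- move=> x; have := deriv_bound_affine m^-1 0 bC.
  rewrite mulr1 gtr0_norm ?invr_gt0// => -[h0 _ [h1 _ [h2 _ _]]].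
  split; first exact: bump_ge0.
  + exact: le_trans (ler_norm _) (h0 x).
  + exact: h1.
  + by rewrite expr2 invfM mulrA; exact: h2.
- by move=> x xm; apply: bump_ge; exact: affine_norm_le1.
Qed.

(* The profile in [x]: increasing at the inner scale [l], where its slope is of
   order [1 / l], and cut off at the outer scale [L], which costs a slope of
   order [1 / L] only. *)
Lemma step_profile (R : realType) : exists c C : R, [/\ 0 < c, 0 < C &
  forall l L, 0 < l -> l <= L -> exists f : R -> R,
    [/\ smoothb f, forall x, 2 * L < `|x| -> f x = 0,
        forall x, [/\ `|f x| <= C, `|derive1 f x| <= C / l,
          `|derive1 (derive1 (derive1 f)) x| <= C / l ^+ 3
          & - (C / L) <= derive1 f x]
      & forall x, `|x| <= l -> c / l - C / L <= derive1 f x]].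
Proof.
have [C C0 [aC bC]] := smoothb_two 3 (smoothb_flat (1 : {poly R})) (smoothb_bump R).
set e := expR (-1) : R; have e0 : 0 < e by exact: expR_gt0.
(* [e / 9] bounds the slope of [flat 1] from below on [[1, 3]] and [e * e] bounds the bump from
   below on [[-1, 1]]; 8 is [2 ^+ 3], from the third derivative of a product. *)
exists (e / 9 * (e * e)), (8 * (C * C)); split.
- by rewrite !mulr_gt0 ?invr_gt0.
- by rewrite !mulr_gt0.
move=> l L l0 lL; have L0 : 0 < L by exact: lt_le_trans lL.
have lV : 0 < l^-1 by rewrite invr_gt0.
have LV : 0 < L^-1 by rewrite invr_gt0.
pose a (x : R) := flat 1 (l^-1 * x + 2) : R.
pose b (x : R) := bump (L^-1 * x + 0) : R.
have sa : smoothb a by apply: smoothb_affine; exact: smoothb_flat.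
have sb : smoothb b by apply: smoothb_affine; exact: smoothb_bump.
have ha : deriv_bound 3 l^-1 C a.
  by have := deriv_bound_affine l^-1 2 aC; rewrite mulr1 (gtr0_norm lV).
(* Since [l <= L], the cut-off also obeys bounds at the larger rate [l^-1], the common rate that
   [deriv_boundM] asks for. *)
have hb : deriv_bound 3 l^-1 C b.
  have := deriv_bound_affine L^-1 0 bC; rewrite mulr1 (gtr0_norm LV) => bL.
  apply: (deriv_bound_le _ _ bL); first by rewrite (ltW LV)/= lef_pV2.
  by rewrite (ltW C0)/=.
have [h0 _ [h1 _ [_ _ [h3 _ _]]]] := deriv_boundM ha hb.
have CC : 0 < C * C by exact: mulr_gt0.
have d1 : derive1 (fun x => a x * b x) =
    fun x => l^-1 * derive1 (flat 1) (l^-1 * x + 2) * b x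
             + a x * (L^-1 * derive1 (@bump R) (L^-1 * x + 0)).
  rewrite (derive1_mul (@smoothb_derivable _ _ sa) (@smoothb_derivable _ _ sb)).
  have [-> _] := derive1_affine l^-1 2 (@smoothb_derivable _ _ (smoothb_flat (1 : {poly R}))).
  by have [-> _] := derive1_affine L^-1 0 (@smoothb_derivable _ _ (smoothb_bump R)).
have tail x : - (8 * (C * C) / L)
    <= a x * (L^-1 * derive1 (@bump R) (L^-1 * x + 0)).
  have : `|a x * (L^-1 * derive1 (@bump R) (L^-1 * x + 0))| <= C * C / L.
    have [ax _ _] := ha; have [_ _ [bx _ _]] := bC.
    rewrite !normrM (gtr0_norm LV) mulrCA [leRHS]mulrC ler_pM2l// ler_pM//.
    by have := bx (L^-1 * x + 0); rewrite mulr1.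
  rewrite ler_norml => /andP[+ _]; apply: le_trans; rewrite lerN2 ler_pM2r//.
  by rewrite ler_peMl ?(ltW CC) ?ler1n.
exists (fun x => a x * b x); split.
- exact: smoothbM.
- move=> x Lx; have -> : b x = 0; last by rewrite mulr0.
  exact: affine_eq0_outside L0 (@bump_eq0 R) _ Lx.
- move=> x; split.
  + by rewrite (le_trans (h0 x))// ler_peMl ?(ltW CC) ?ler1n.
  + rewrite (le_trans (h1 x))// mulrA ler_pM2r// mulrC ler_pM2r//.
    by rewrite ler_nat.
  + apply: le_trans (h3 x) _; rewrite le_eqVlt; apply/orP; left; apply/eqP.
    by field; rewrite gt_eqF.
  + rewrite d1 -[leLHS]add0r; apply: lerD; last exact: tail.
    by rewrite mulr_ge0 ?bump_ge0// mulr_ge0 ?(ltW lV) ?derive1_flat1_ge0.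
- move=> x xl; rewrite d1; apply: lerD; last exact: tail.
  have : `|l^-1 * x + 0| <= 1 by exact: affine_norm_le1.
  rewrite addr0 ler_norml => /andP[x1 x2].
  rewrite [leLHS]mulrC -[leRHS]mulrA ler_pM2l// ler_pM ?mulr_ge0 ?expR_ge0//.
    by apply: derive1_flat1_ge; lra.
  by apply: bump_ge; apply: affine_norm_le1 => //; exact: le_trans lL.
Qed.

(** * The virial estimate on a time window *)

(** Expand [(k * w + A)^2 / (2 * k) >= 0]. *)
Lemma young_lower (R : realFieldType) (k w A al : R) : 0 < k -> `|A| <= al ->
  - (k / 2 * w ^+ 2 + al ^+ 2 / (2 * k)) <= w * A.
Proof.
move=> k0 Aal.
have A2 : A ^+ 2 / (2 * k) <= al ^+ 2 / (2 * k).
  rewrite ler_pM2r ?invr_gt0 ?mulr_gt0// -[A ^+ 2]ger0_norm ?sqr_ge0// normrX.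
  by rewrite lerXn2r ?nnegrE// (le_trans _ Aal).
rewrite -subr_ge0.
have sq : 0 <= (k * w + A) ^+ 2 / (2 * k).
  by rewrite mulr_ge0 ?sqr_ge0// invr_ge0 mulr_ge0// ltW.
have e : (k * w + A) ^+ 2 / (2 * k)
    = k / 2 * w ^+ 2 + w * A + A ^+ 2 / (2 * k).
  by field; rewrite gt_eqF.
move: sq; rewrite e; lra.
Qed.

Lemma double_lt (R : realDomainType) (a x : R) : 0 < a -> 2 * a < x -> a < x.
Proof. lra. Qed.

Lemma window_norm_le (R : realFieldType) (S t : R) :
  0 < S -> S / 2 <= t <= S -> `|t| <= S.
Proof. by move=> S0 /andP[t1 t2]; rewrite ger0_norm; lra. Qed.

(** The three terms in the squared sum come from [Dt], from the third derivative in [x] and from the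
    mixed derivative of the test function; [L * mu] is the order of the area of its support, and [k]
    is the free parameter of Young's inequality. A lower bound [m] valid at every time of the window
    replaces a time average of the mass. *)
Lemma virial_estimate (R : realType) : exists2 K : R, 0 < K &
  forall (u : R -> R * R -> R) (E : R),
  (forall t, u t \in Lfun (leb2 R) 2%:E) -> ZK_distributional u ->
  (forall t, \int[leb2 R]_p ((u t p) ^+ 2)%:E <= E%:E)%E ->
  forall l L mu S k m : R,
  0 < l -> l <= L -> 0 < mu -> 0 < S -> 0 < k -> 0 <= m ->
  (forall t, (S / 2 <= t <= S)%R ->
    m%:E <= \int[leb2 R]_(p in [set p | (`|p.1| < l)%R /\ (`|p.2| < mu)%R])
      ((u t p) ^+ 2)%:E)%E ->
  m <= K * (l * (k + L^-1) * E
    + l * (S^-1 + (l ^+ 3)^-1 + (l * mu ^+ 2)^-1) ^+ 2 * (L * mu) / k).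
Proof.
have [c1 [C1 [c10 C10 Hf]]] := step_profile R.
have [c2 [C2 [c20 C20 Hg]]] := bump_profile R.
pose P := C1 * C2 ^+ 2; pose c := c1 * c2 ^+ 2.
have P0 : 0 < P by rewrite mulr_gt0// exprn_gt0.
have c0 : 0 < c by rewrite mulr_gt0// exprn_gt0.
have K0 : 0 < 1 + P + 8 * P ^+ 2 by have := sqr_ge0 P; lra.
(* [16 / c] combines the ratio 8 of the time intervals with the division by [c / (2 * l)]; [1 + P]
   covers the terms in [E], and [8 * P ^+ 2] the term quadratic in [al]. *)
exists (16 / c * (1 + P + 8 * P ^+ 2)); first by rewrite mulr_gt0// divr_gt0.
move=> u E uL2 uZK uE l L mu S k m l0 lL mu0 S0 k0 m0 um.
have L0 : 0 < L by exact: lt_le_trans lL.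
have [f [sf f0 fC fc]] := Hf l L l0 lL.
have [g [sg g0 gC gc]] := Hg mu mu0.
have [h [sh h0 hC hc]] := Hg S S0.
have E0 : 0 <= E.
  by rewrite -lee_fin (le_trans _ (uE 0))// integral_ge0// => p _;
    rewrite lee_fin sqr_ge0.
set sg3 := S^-1 + _ + _.
have sg30 : 0 <= sg3.
  by rewrite !addr_ge0 ?invr_ge0 ?mulr_ge0 ?exprn_ge0 ?(ltW S0) ?(ltW l0) ?(ltW mu0).
(* [al] bounds the coefficient of the terms linear in [u]; in [B], [16 * L * mu] is the area of the
   box [|x| <= 2 * L], [|y| <= 2 * mu]. *)
pose al := P * sg3.
pose B := (k / 2 + P / (2 * L)) * E + al ^+ 2 / (2 * k) * (16 * L * mu).
have fd0 := derive1_eq0_outside f0.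
have fddd0 := derive1_eq0_outside (derive1_eq0_outside fd0).
have gdd0 := derive1_eq0_outside (derive1_eq0_outside g0).
have hd0 := derive1_eq0_outside h0.
have boundA x y t : `|f x * g y * derive1 h t
    + (derive1 (derive1 (derive1 f)) x * g y * h t
       + derive1 f x * derive1 (derive1 g) y * h t)| <= al.
  have [fx f1x f3x _] := fC x; have [gy0 gy _ g2y] := gC y.
  have [ht0 ht h1t _] := hC t.
  rewrite (le_trans (ler_normD _ _))// (_ : al = C1 * C2 * (C2 / S)
    + (C1 / l ^+ 3 * C2 * C2 + C1 / l * (C2 / mu ^+ 2) * C2)); last first.
    by rewrite /al /P /sg3; field; rewrite !gt_eqF.
  apply: lerD; first by rewrite !normrM !ler_pM// ?mulr_ge0// ger0_norm.
  rewrite (le_trans (ler_normD _ _))//; apply: lerD.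
    by rewrite !normrM !ler_pM// ?mulr_ge0// ger0_norm.
  by rewrite !normrM !ler_pM// ?mulr_ge0// ger0_norm.
(* The boolean tells whether the gain of order [1 / l] is claimed, so that one inequality serves
   inside and outside the inner region. *)
have boundB x y t (b : bool) :
    (b -> [/\ `|x| <= l, `|y| <= mu & `|t| <= S]) ->
    b%:R * (c / l) - P / L <= derive1 f x * g y * h t.
  move=> hb; have [gy0 gy _ _] := gC y; have [ht0 ht _ _] := hC t.
  have [_ _ _ fx] := fC x.
  have gh0 : 0 <= g y * h t by exact: mulr_ge0.
  have ghC : g y * h t <= C2 ^+ 2 by rewrite expr2 ler_pM.
  have CL : C1 / L * (g y * h t) <= P / L.
    by rewrite /P [leRHS]mulrAC ler_pM2l// divr_gt0.
  rewrite -mulrA; case: b hb => [/(_ isT)[xl ym tS]|_]; last first.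
    have := ler_wpM2r gh0 fx; rewrite mul0r => H1.
    by rewrite (le_trans _ H1)// mulNr sub0r lerN2.
  have := ler_wpM2r gh0 (fc x xl); rewrite mulrBl mul1r => H1.
  apply: le_trans H1; apply: lerB => //.
  rewrite /c [leLHS]mulrAC ler_pM2l ?divr_gt0// expr2.
  by apply: ler_pM; rewrite ?(ltW c20) ?gc ?hc.
have e0 : 0 <= k / 2 + P / (2 * L).
  by apply: addr_ge0; apply: divr_ge0; rewrite ?mulr_ge0 ?ltW.
have D0 : 0 <= al ^+ 2 / (2 * k).
  by apply: divr_ge0; rewrite ?sqr_ge0// mulr_ge0 ?ltW.
have V0 : 0 <= 16 * L * mu by rewrite !mulr_ge0 ?(ltW L0) ?(ltW mu0).
have B0 : 0 <= B by apply: addr_ge0; exact: mulr_ge0.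
have test : test_function (tensor3 f g h).
  exact: test_function_tensor3 sf sg sh f0 g0 h0.
have win0 := uZK _ test.
pose I1 := `[S / 2, S]%classic; pose I2 := `[- (2 * S), 2 * S]%classic.
pose Om : set (measurableTypeR R * measurableTypeR R) :=
  [set p | `|p.1| < l /\ `|p.2| < mu].
pose Q : set (measurableTypeR R * measurableTypeR R) :=
  [set x : R | `|x| <= 2 * L] `*` [set y : R | `|y| <= 2 * mu].
have mQ : measurable Q by rewrite /Q !normr_le_itv; exact: measurableX.
have I1E t : \1_I1 t = (S / 2 <= t <= S)%R%:R :> R.
  rewrite indicE; congr (nat_of_bool _)%:R.
  by apply/idP/idP; rewrite inE /I1/= in_itv/=.
have I2E t : \1_I2 t = (`|t| <= 2 * S)%R%:R :> R.
  rewrite indicE; congr (nat_of_bool _)%:R.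
  by apply/idP/idP; rewrite inE /I2/= in_itv/= ler_norml.
have OmE x y : \1_Om (x, y) = ((`|x| < l) && (`|y| < mu))%R%:R :> R.
  rewrite indicE; congr (nat_of_bool _)%:R.
  by apply/idP/idP; rewrite inE => /andP.
have QE x y : \1_Q (x, y) = ((`|x| <= 2 * L) && (`|y| <= 2 * mu))%R%:R :> R.
  rewrite indicE; congr (nat_of_bool _)%:R.
  by apply/idP/idP; rewrite inE => /andP.
(* By Young's inequality the terms linear in [w] cost only a small multiple of
   [w ^+ 2] plus a constant on the support of the test function; the quadratic
   term is bounded below by the slope of the profile. *)
have pointwise x y t (w : R) :
    c / (2 * l) * \1_I1 t * (w ^+ 2 * \1_Om (x, y))
    - ((k / 2 + P / (2 * L)) * \1_I2 t * w ^+ 2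
       + al ^+ 2 / (2 * k) * \1_I2 t * \1_Q (x, y))
    <= w * (f x * g y * derive1 h t
            + (derive1 (derive1 (derive1 f)) x * g y * h t
               + derive1 f x * derive1 (derive1 g) y * h t))
       + w ^+ 2 / 2 * (derive1 f x * g y * h t).
  have w0 : 0 <= w ^+ 2 by exact: sqr_ge0.
  have ew0 := mulr_ge0 e0 w0.
  rewrite I1E I2E OmE QE; case: (leP `|t| (2 * S)) => tS; last first.
    have -> : (S / 2 <= t <= S) = false.
      by apply/negP => /(window_norm_le S0); apply/negP; rewrite -ltNge double_lt.
    by rewrite (h0 _ tS) (hd0 _ tS) !(mulr0, mul0r, addr0, subr0).
  case: (leP `|x| (2 * L)) => xL; last first.
    have -> : (`|x| < l) = false.
      by rewrite ltNge (le_trans lL)// ltW// double_lt.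
    rewrite (f0 _ xL) (fd0 _ xL) (fddd0 _ xL) !(mulr0, mul0r, addr0, mulr1).
    by rewrite sub0r oppr_le0.
  case: (leP `|y| (2 * mu)) => ym; last first.
    have -> : (`|y| < mu) = false by rewrite ltNge ltW// double_lt.
    rewrite andbF (g0 _ ym) (gdd0 _ ym) !(mulr0, mul0r, addr0, mulr1).
    by rewrite sub0r oppr_le0.
  have hA := young_lower w k0 (boundA x y t).
  pose b := (S / 2 <= t <= S) && ((`|x| < l) && (`|y| < mu)).
  have hb : b -> [/\ `|x| <= l, `|y| <= mu & `|t| <= S].
    by move=> /and3P[/(window_norm_le S0) tS' x1 y1]; split => //; exact: ltW.
  have w20 : 0 <= w ^+ 2 / 2 by rewrite divr_ge0.
  have hB := ler_wpM2l w20 (boundB x y t b hb).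
  apply: le_trans (lerD hA hB).
  (* On the support, the two lower bounds add up exactly to the left-hand side: what remains is an
     identity. *)
  have eqW (y1 y2 : R) : y1 = y2 -> y1 <= y2 by move=> ->.
  apply: eqW; rewrite /b /= !mulr1n; clear b hb hB.
  move: (S / 2 <= t <= S) ((`|x| < l) && (`|y| < mu)) => b1 b2.
  rewrite -mulnb natrM; move: (b1%:R : R) (b2%:R : R) => r1 r2.
  by field; rewrite !gt_eqF.
have {win0} : c / (2 * l) * m <= 8 * B.
  apply: (integral0_window S0 _ B0 win0).
    by apply: mulr_ge0 => //; apply: divr_ge0; rewrite ?mulr_ge0 ?ltW.
  move=> t; set F := (X in (_ <= integral _ _ X)%E).
  have ind0 (A : set R) : 0 <= \1_A t :> R by rewrite indicE.
  apply: le_trans (@integral_ge_box _ _ _ (leb2 R) (u t) Om Q F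
    (c / (2 * l) * \1_I1 t) ((k / 2 + P / (2 * L)) * \1_I2 t)
    (al ^+ 2 / (2 * k) * \1_I2 t) E (16 * L * mu)
    (Lfun2_integrable_sqr (uL2 t)) (measurable_Omega _ _) mQ _ _ (uE t) _ _).
  - rewrite EFinB; apply: leeB; last first.
      by rewrite lee_fin le_eqVlt; apply/orP; left; apply/eqP; rewrite /B; ring.
    (* Outside the window the indicator cancels the mass term, so [um] is invoked only where it
       holds. *)
    rewrite -/I1 I1E; case: (boolP (S / 2 <= t <= S)) => [tI|_].
      rewrite !mulr1 EFinM; apply: lee_wpmul2l; last exact: um.
      by rewrite lee_fin divr_ge0 ?mulr_ge0 ?ltW.
    by rewrite !mulr0 mul0e.
  - exact: mulr_ge0.
  - exact: mulr_ge0.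
  - rewrite leb2_box ?mulr_ge0 ?(ltW L0) ?(ltW mu0)// lee_fin le_eqVlt.
    by apply/orP; left; apply/eqP; ring.
  - move=> [x y]; rewrite /F lee_fin Dt_tensor3// Dx_tensor3//.
    by rewrite Dx_laplacian_tensor3//; exact: pointwise.
move=> mB.
have -> : m = 2 * l / c * (c / (2 * l) * m) by field; rewrite !gt_eqF.
apply: le_trans (ler_wpM2l _ mB) _; first by rewrite divr_ge0 ?mulr_ge0 ?ltW.
rewrite /B /al.
have -> : 2 * l / c * (8 * ((k / 2 + P / (2 * L)) * E
    + (P * sg3) ^+ 2 / (2 * k) * (16 * L * mu)))
  = 16 / c * (l * (k / 2 + P / (2 * L)) * E
      + 8 * P ^+ 2 * (l * sg3 ^+ 2 * (L * mu) / k)).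
  by field; rewrite !gt_eqF.
rewrite -[leRHS]mulrA ler_pM2l ?divr_gt0// [leRHS]mulrDr; apply: lerD.
  rewrite [leRHS]mulrA ler_wpM2r// mulrCA ler_pM2l//; clear -P0 L0 k0.
  have P2 := sqr_ge0 P; have LV : 0 < L^-1 by rewrite invr_gt0.
  have := mulr_gt0 P0 LV; have := mulr_ge0 P2 (ltW LV).
  have := mulr_gt0 P0 k0; have := mulr_ge0 P2 (ltW k0).
  rewrite invfM; lra.
apply: ler_wpM2r; last by rewrite lerDr addr_ge0// ltW.
by rewrite divr_ge0 ?(ltW k0)// !mulr_ge0 ?sqr_ge0 ?(ltW l0) ?(ltW L0) ?(ltW mu0).
Qed.

(** * Choice of the scales and power decay of the mass *)

Lemma local_mass_ge0 (R : realType) (b r : R) u t :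
  (0 <= local_mass b r u t :> \bar R)%E.
Proof. by apply: integral_ge0 => p _; rewrite lee_fin sqr_ge0. Qed.

(** By contradiction: a mass above [K * S ^ (-d)] during the whole window would violate the virial
    estimate taken at scales that are powers of [S]. *)
Lemma local_mass_decay (R : realType) (r b : R) (u0 : R * R -> R)
    (u : R -> R * R -> R) :
  1 / 3 < r < 3 -> 0 < b < 2 / (3 + r) -> ZK_solution u0 u ->
  exists K d : R, [/\ 0 < K, 0 < d & forall S, 1 <= S ->
    exists t, S / 2 <= t <= S
      /\ (local_mass b r u t <= (K * S `^ (- d))%:E)%E].
Proof.
move=> /andP[r1 r3] /andP[b0 b2] [[uL2 _] [M uM] uZK _].
have [K0 K0_gt0 virial] := virial_estimate R.
have br : b * (3 + r) < 2 by rewrite -ltr_pdivlMr//; lra.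
have [d [d0 d1 d2 d3]] : exists d : R, [/\ 0 < d, b * (3 + r) + 3 * d <= 2,
    3 * d <= b * (3 - r) & 3 * d <= b * (3 * r - 1)].
  (* The three margins are positive precisely because [b < 2 / (3 + r)], [r < 3] and [1 / 3 < r]. *)
  pose d : R := Num.min ((2 - b * (3 + r)) / 3)
    (Num.min (b * (3 - r) / 3) (b * (3 * r - 1) / 3)).
  have [dA dB dC] : [/\ d <= (2 - b * (3 + r)) / 3, d <= b * (3 - r) / 3
      & d <= b * (3 * r - 1) / 3].
    by rewrite /d; split; rewrite !ge_min lexx ?orbT.
  exists d; split; [|lra|lra|lra].
  by rewrite !lt_min !divr_gt0 ?mulr_gt0//; lra.
pose E := M ^+ 2.
have uE t : (\int[leb2 R]_p ((u t p) ^+ 2)%:E <= E%:E)%E.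
  exact: sqr_L2norm_le.
have E0 : 0 <= E by exact: sqr_ge0.
(* [2 * E] is the contribution of [l * (k + L^-1) * E], and 9 is the square of the 3 in [sg_le]; the
   final 1 makes the contradiction strict. *)
pose K := K0 * (2 * E + 9) + 1.
have K_gt0 : 0 < K by rewrite ltr_wpDl// mulr_ge0 ?(ltW K0_gt0)//; lra.
exists K, d; split => // S S1; apply/not_existsP => mass.
have S0 : 0 < S by exact: lt_le_trans S1.
have pw x : 0 < S `^ x by exact: powR_gt0.
have pD x y : S `^ x * S `^ y = S `^ (x + y).
  by rewrite powRD// (gt_eqF S0) implybT.
have pV x : (S `^ x)^-1 = S `^ (- x) by rewrite powRN.
have pX x n : S `^ x ^+ n = S `^ (x * n%:R) by rewrite -powR_mulrn ?ltW// powRrM.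
have ple x y : x <= y -> S `^ x <= S `^ y by exact: ler_powR.
(* With these scales [l * (k + L^-1)] is of order [S `^ (- d)], and the three
   upper bounds on [d] say that [S^-1], [l ^- 3] and [(l * mu ^+ 2)^-1] are at
   most [S `^ (- s)], where [s] is chosen so that the remaining term is also of
   order [S `^ (- d)]. *)
have := virial u E uL2 uZK uE (S `^ b) (S `^ (b + d)) (S `^ (b * r)) S
  (S `^ (- d - b)) (K * S `^ (- d)) (pw _) _ (pw _) S0 (pw _) _ _.
move=> /(_ _ _ _)/wrap[]; first by apply: ple; lra.
- by rewrite mulr_ge0 ?ltW.
- move=> t /[dup] tS /andP[t1 t2]; apply: ltW.
  have t0 : 0 < t by rewrite (lt_le_trans _ t1)// divr_gt0.
  have /not_andP[//|/negP] := mass t; rewrite -ltNge => /lt_le_trans; apply.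
  (* As [t <= S] and the exponents are nonnegative, [Omega b r t] lies in the box with the scales of
     [S]. *)
  apply: ge0_subset_integral => //.
  + exact: measurable_Omega.
  + exact: measurable_Omega.
  + apply/measurable_EFinP; apply: measurable_funX.
    apply: measurable_funTS; have /andP[] := uL2 t.
    by rewrite inE.
  + by move=> p _; rewrite lee_fin sqr_ge0.
  + move=> p [/lt_le_trans px /lt_le_trans py]; split; [apply: px|apply: py];
      by rewrite ge0_ler_powR ?nnegrE ?(ltW t0) ?(ltW S0)// ?mulr_ge0 ?ltW//; lra.
apply/negP; rewrite -ltNge.
pose s := (b * (3 + r) + 3 * d) / 2.
set sg := _ + _ + _.
have sgE : sg = S `^ (-1) + S `^ (- (b * 3)) + S `^ (- (b + b * r * 2)).
  by rewrite /sg pX pX pD !pV -[S^-1]powR_inv1 ?(ltW S0).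
have sg_le : sg <= 3 * S `^ (- s).
  have -> : 3 * S `^ (- s) = S `^ (- s) + S `^ (- s) + S `^ (- s) by ring.
  by rewrite sgE; do 2?apply: lerD; apply: ple; rewrite /s; lra.
have sg0 : 0 <= sg by rewrite sgE !addr_ge0 ?powR_ge0.
apply: (@le_lt_trans _ _ (K0 * ((2 * E + 9) * S `^ (- d)))); last first.
  by rewrite mulrA ltr_pM2r// /K ltrDl.
rewrite ler_pM2l// mulrDl; apply: lerD.
  rewrite pV mulrDr !pD.
  have -> : b + (- d - b) = - d by ring.
  have -> : b - (b + d) = - d by ring.
  by rewrite le_eqVlt; apply/orP; left; apply/eqP; ring.
have sg2 : sg ^+ 2 <= 9 * S `^ (- s * 2).
  have -> : 9 * S `^ (- s * 2) = (3 * S `^ (- s)) ^+ 2.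
    by rewrite exprMn pX; congr (_ * _); ring.
  by rewrite lerXn2r ?nnegrE// mulr_ge0 ?powR_ge0.
(* The exponents of [l], [L], [mu] and [1 / k] add up to [b * (3 + r) + 2 * d = 2 * s - d]; the
   bound on [sg ^+ 2] contributes [- 2 * s], which leaves [- d]. *)
rewrite pV [S `^ b * _]mulrC -!mulrA !pD mulrA -expr2.
apply: le_trans (ler_wpM2r (powR_ge0 _ _) sg2) _.
rewrite -mulrA pD ler_pM2l//; apply: ple; rewrite /s; lra.
Qed.

(** * From power decay to the limit inferior and the logarithmic rate *)

(** [ln t = (a / d) * ln (t ^ (d / a))], and [ln x < x] for [0 < x]; then raise to the power [a]. *)
Lemma ln_powR_le (R : realType) (a d t : R) : 0 < a -> 0 < d -> 1 <= t ->
  ln t `^ a <= (a / d) `^ a * t `^ d.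
Proof.
move=> a0 d0 t1; have t0 : 0 < t by exact: lt_le_trans t1.
have lnt0 : 0 <= ln t by exact: ln_ge0.
have ad0 : 0 <= a / d by rewrite divr_ge0 ?ltW.
have -> : (a / d) `^ a * t `^ d = (a / d * t `^ (d / a)) `^ a.
  rewrite [RHS]powRM ?powR_ge0// -powRrM.
  by rewrite divfK ?gt_eqF.
apply: ge0_ler_powR; [exact: ltW|exact: lnt0|exact: mulr_ge0 (powR_ge0 _ _)|].
rewrite -ler_pdivrMl ?divr_gt0// invf_div -ln_powR.
by apply/ltW/ln_sublinear; exact: powR_gt0.
Qed.

Theorem theorem1p2 (R : realType) (r b : R)
    (hr : 1 / 3 < r < 3) (hb : 0 < b < 2 / (3 + r))
    (u0 : R * R -> R) (hu0 : u0 \in Lfun (leb2 R) 2%:E)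
    (u : R -> R * R -> R) (hu : ZK_solution u0 u) :
  limf_einf (local_mass b r u) +oo = 0%E /\
  exists (C0 : R) (t_ : nat -> R),
    [/\ 0 < C0,
        forall n, 2 <= t_ n,
        {homo t_ : m n / (m < n)%N >-> m < n},
        t_ n @[n --> \oo] --> +oo
      & forall n, (local_mass b r u (t_ n)
                   <= (C0 / ln (t_ n) `^ (b^-1 - 1))%:E)%E].
Proof.
have [K [d [K0 d0 decay]]] := local_mass_decay hr hb hu.
move: hr hb => /andP[r1 r3] /andP[b0 b2].
split.
  rewrite limf_einfE; apply/eqP; rewrite eq_le; apply/andP; split.
    apply: ge_ereal_sup => _ [V [A [_ AV]] <-].
    apply/lee_addgt0Pr => e e0; rewrite add0e.
    (* Large enough that the window starts beyond [A] and that [K * S ^ (-d) <= e]. *)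
    pose S := 3 + 2 * `|A| + (K / e) `^ d^-1.
    have A0 := normr_ge0 A; have P0 := powR_ge0 (K / e) d^-1.
    have S0 : 0 < S by rewrite /S; lra.
    have [|t [/andP[tS _] mt]] := decay S; first by rewrite /S; lra.
    apply: (@le_trans _ _ (local_mass b r u t)).
      apply: ereal_inf_lbound; exists t => //; apply: AV.
      rewrite (le_lt_trans (ler_norm A))// (lt_le_trans _ tS)// /S.
      by set P := _ `^ _ in P0 *; lra.
    apply: (le_trans mt); rewrite lee_fin powRN ler_pdivrMr ?powR_gt0//.
    rewrite mulrC -ler_pdivrMr//.
    apply: (@le_trans _ _ (((K / e) `^ d^-1) `^ d)).
      by rewrite -powRrM mulVf ?gt_eqF// powRr1// divr_ge0 ?ltW.
    apply: ge0_ler_powR; [exact: ltW|exact: P0|exact: ltW|by rewrite /S; lra].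
  (* For nonnegativity, the whole line is taken as the neighbourhood of infinity. *)
  apply: (@le_trans _ _ (ereal_inf (local_mass b r u @` setT))).
    by apply: le_ereal_inf_tmp => _ [t _ <-]; exact: local_mass_ge0.
  by apply: ereal_sup_ubound; exists setT => //; exact: filterT.
(* With ratio 4 the windows [[S n / 2, S n]] are disjoint and ordered, so the times increase
   strictly; starting at 4 ensures [2 <= t_ n]. *)
pose S n : R := 4 ^+ n.+1.
have S4 n : 4 <= S n.
  by rewrite /S exprS ler_peMr// exprn_ege1// ler1n.
have S1 n : 1 <= S n by have := S4 n; lra.
have [t_ ht] := choice (fun n => decay (S n) (S1 n)).
have t2 n : 2 <= t_ n.
  by have [/andP[tS _] _] := ht n; have := S4 n; lra.
have a0 : 0 < b^-1 - 1.
  have b1 : b < 1 by rewrite (lt_le_trans b2)// ler_pdivrMr; lra.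
  by rewrite subr_gt0 invf_gt1.
exists (K * ((b^-1 - 1) / d) `^ (b^-1 - 1)), t_; split => //.
- by rewrite mulr_gt0// powR_gt0// divr_gt0.
- move=> m n mn; have [/andP[_ tm] _] := ht m; have [/andP[tn _] _] := ht n.
  have Smn : 4 * S m <= S n by rewrite /S -exprS ler_eXn2l// ?ltr1n.
  by have := S4 m; lra.
- apply/cvgryPge => A; near=> n.
  have [/andP[tn _] _] := ht n.
  have nA : A <= n%:R by near: n; exact: nbhs_infty_ger.
  have : n%:R <= S n / 2.
    have n4 : n%:R <= 4 ^+ n :> R.
      by rewrite -natrX ler_nat; apply/ltnW/ltn_expl.
    by have := ler0n R n; rewrite /S exprS; lra.
  by move: nA; lra.
- move=> n; have [/andP[_ tS] /le_trans] := ht n; apply.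
  have t0 : 0 < t_ n by rewrite (lt_le_trans _ (t2 n)).
  have ln0 : 0 < ln (t_ n) by rewrite ln_gt0// (lt_le_trans _ (t2 n))// ltr1n.
  rewrite lee_fin -mulrA ler_pM2l// ler_pdivlMr ?powR_gt0//.
  have S0 : 0 < S n `^ d by rewrite powR_gt0// (lt_le_trans _ (S4 n)).
  rewrite powRN mulrC ler_pdivrMr//.
  have t1 : 1 <= t_ n by rewrite (le_trans _ (t2 n))// ler1n.
  (* The power of the logarithm is at most a constant times [t_ n ^ d], hence times [S n ^ d]
     because [t_ n <= S n]. *)
  apply: le_trans (ln_powR_le a0 d0 t1) _.
  rewrite ler_wpM2l ?powR_ge0//.
  apply: ge0_ler_powR => //; rewrite ?nnegrE; first exact: ltW.
    exact: ltW.
  by rewrite (le_trans _ (S4 n)).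
Unshelve. all: by end_near.
Qed.
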